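(* The Cambrian lattices of type A are exactly the quotients of permutohedra by their minimal meet-irreducible congruences. That is, the lattices of the form $\mathsf{P}(n)/\eta_U$, with $n\ge2$ and $U\subseteq\{2,\dots,n-1\}$, are exactly the lattices of the form $\mathsf{P}(n)/\psi$, with $n\ge2$ and $\psi$ minimal (with respect to inclusion) among the meet-irreducible elements of the congruence lattice of $\mathsf{P}(n)$.
   Context: Notation: $[n]=\{1,\dots,n\}$ and $\mathcal{I}_n=\{(i,j)\in[n]\times[n] : i<j\}$. Permutohedra: a subset $\boldsymbol x\subseteq\mathcal{I}_n$ is closed if it is transitive as a binary relation, and clopen if both $\boldsymbol x$ and $\mathcal{I}_n\setminus\boldsymbol x$ are closed. The permutohedron $\mathsf{P}(n)$ is the set of all clopen subsets of $\mathcal{I}_n$, ordered by inclusion; it is a lattice. Cambrian lattices of type A: for $n\ge2$, an orientation of the Dynkin diagram of the symmetric group on $n$ letters is encoded by a subset $U$ of $\{2,3,\dots,n-1\}$. The Cambrian congruence associated to $U$ is the lattice congruence $\eta_U$ of $\mathsf{P}(n)$ generated by the following pairs, for $1\le i\le n-2$ (permutations being identified with their inversion sets): $$\{(i+1,i+2)\}\equiv\{(i+1,i+2),(i,i+2)\}\quad\text{if }i+1\in U,$$ $$\{(i,i+1)\}\equiv\{(i,i+1),(i,i+2)\}\quad\text{if }i+1\notin U.$$ The associated Cambrian lattice is $\mathsf{P}(n)/\eta_U$. Meet-irreducible elements of a finite lattice are those elements, distinct from the largest element, that are not the meet of two strictly larger elements. *)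

(* Defs.v *)
From HB Require Import structures.
From mathcomp Require Import all_boot all_order zify.

Set Implicit Arguments.
Unset Strict Implicit.
Unset Printing Implicit Defensive.

Import Order.TTheory.

Local Open Scope order_scope.

Section LatticeNotions.

Definition lattice_isomorphic d (L : latticeType d) d' (M : latticeType d') :
  Prop := exists f : {lmorphism L -> M}, bijective f.

Definition meet_irreducible d (L : tLatticeType d) (x : L) : Prop :=
  x <> \top /\ ~ (exists y z : L, [/\ x < y, x < z & x = y `&` z]).

Definition minimal_meet_irreducible d (L : tLatticeType d) (x : L) : Prop :=
  meet_irreducible x /\
  forall y : L, meet_irreducible y -> y <= x -> y = x.

End LatticeNotions.

(* Congruences of a finite lattice, as sets of pairs ordered by inclusion. *)

Section Congruence.
Context {d : Order.disp_t} {L : finLatticeType d}.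
Implicit Types (R G : {set L * L}) (a b c : L).

Definition is_congruence R : bool :=
  [&& [forall a, (a, a) \in R],
      [forall a, forall b, ((a, b) \in R) ==> ((b, a) \in R)],
      [forall a, forall b, forall c,
         ((a, b) \in R) && ((b, c) \in R) ==> ((a, c) \in R)]
    & [forall a, forall a', forall b, forall b',
         ((a, a') \in R) && ((b, b') \in R) ==>
         ((a `&` b, a' `&` b') \in R) && ((a `|` b, a' `|` b') \in R)]].

Lemma is_congruenceP R :
  reflect [/\ forall a, (a, a) \in R,
              forall a b, (a, b) \in R -> (b, a) \in R,
              forall a b c, (a, b) \in R -> (b, c) \in R -> (a, c) \in R
            & forall a a' b b', (a, a') \in R -> (b, b') \in R ->
                (a `&` b, a' `&` b') \in R /\ (a `|` b, a' `|` b') \in R]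
          (is_congruence R).
Proof.
apply: (iffP and4P) => -[h1 h2 h3 h4]; split.
- exact/forallP.
- by move=> a b; move/forallP/(_ a)/forallP/(_ b)/implyP: h2.
- move=> a b c ab bc.
  move/forallP/(_ a)/forallP/(_ b)/forallP/(_ c)/implyP: h3; apply.
  by rewrite ab.
- move=> a a' b b' aa bb.
  move/forallP/(_ a)/forallP/(_ a')/forallP/(_ b)/forallP/(_ b')/implyP: h4.
  by rewrite aa bb => /(_ isT)/andP.
- exact/forallP.
- by apply/forallP => a; apply/forallP => b; apply/implyP; apply: h2.
- apply/forallP => a; apply/forallP => b; apply/forallP => c.
  by apply/implyP => /andP[]; apply: h3.
- apply/forallP => a; apply/forallP => a'; apply/forallP => b.
  apply/forallP => b'; apply/implyP => /andP[aa bb]; apply/andP; exact: h4.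
Qed.

Lemma is_congruenceT : is_congruence [set: L * L].
Proof. by apply/is_congruenceP; split=> *; rewrite !inE. Qed.

Lemma is_congruenceI R S :
  is_congruence R -> is_congruence S -> is_congruence (R :&: S).
Proof.
move=> /is_congruenceP[r1 r2 r3 r4] /is_congruenceP[s1 s2 s3 s4].
apply/is_congruenceP; split.
- by move=> a; rewrite inE r1 s1.
- by move=> a b; rewrite !inE => /andP[/r2-> /s2->].
- move=> a b c; rewrite !inE => /andP[ra sa] /andP[rb sb].
  by rewrite (r3 _ _ _ ra rb) (s3 _ _ _ sa sb).
- move=> a a' b b'; rewrite !inE => /andP[ra sa] /andP[rb sb].
  have [-> ->] := r4 _ _ _ _ ra rb.
  by have [-> ->] := s4 _ _ _ _ sa sb.
Qed.

Definition generated_set G : {set L * L} :=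
  \bigcap_(R : {set L * L} | is_congruence R && (G \subset R)) R.

Lemma generated_congruence G : is_congruence (generated_set G).
Proof.
apply: (big_ind (fun R => is_congruence R)); first exact: is_congruenceT.
- exact: is_congruenceI.
- by move=> R /andP[].
Qed.

End Congruence.

Arguments is_congruence {d L} R.

Record congruence d (L : finLatticeType d) :=
  Congruence { con_set :> {set L * L}; _ : is_congruence con_set }.

HB.instance Definition _ d (L : finLatticeType d) :=
  [isSub for @con_set d L].
HB.instance Definition _ d (L : finLatticeType d) :=
  [Finite of congruence L by <:].

Section CongruenceLattice.
Context {d : Order.disp_t} {L : finLatticeType d}.
Implicit Types (t u v : congruence L) (G : {set L * L}).

Definition con_gen G : congruence L := Congruence (generated_congruence G).

Lemma con_gen_min G t : (con_gen G \subset t) = (G \subset t).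
Proof.
apply/idP/idP => [|Gt].
  apply: subset_trans; apply/bigcapsP => R; by case/andP.
by apply: (bigcap_inf (con_set t)); rewrite Gt andbT; case: t {Gt}.
Qed.

Definition con_le t u : bool := con_set t \subset con_set u.

Lemma con_le_refl : reflexive con_le.
Proof. by move=> t; apply: subxx. Qed.

Lemma con_le_anti : antisymmetric con_le.
Proof. by move=> t u tu; apply/val_inj/eqP; rewrite eqEsubset. Qed.

Lemma con_le_trans : transitive con_le.
Proof. by move=> u t v; apply: subset_trans. Qed.

HB.instance Definition _ :=
  Order.Le_isPOrder.Build Order.SetSubsetOrder.subset_display (congruence L)
    con_le_refl con_le_anti con_le_trans.

Definition con_meet t u : congruence L :=
  Congruence (is_congruenceI (valP t) (valP u)).

Definition con_join t u : congruence L := con_gen (t :|: u).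

Lemma con_meetP t u v : (t <= con_meet u v) = (t <= u) && (t <= v).
Proof. exact: subsetI. Qed.

Lemma con_joinP t u v : (con_join t u <= v) = (t <= v) && (u <= v).
Proof. exact: etrans (con_gen_min _ _) (subUset _ _ _). Qed.

HB.instance Definition _ :=
  Order.POrder_MeetJoin_isLattice.Build Order.SetSubsetOrder.subset_display (congruence L)
    con_meetP con_joinP.

Lemma con_ge_bot t : con_gen set0 <= t.
Proof. exact: etrans (con_gen_min _ _) (sub0set _). Qed.

Lemma con_le_top t : t <= Congruence is_congruenceT.
Proof. exact: subsetT. Qed.

HB.instance Definition _ :=
  Order.hasBottom.Build Order.SetSubsetOrder.subset_display (congruence L) con_ge_bot.
HB.instance Definition _ :=
  Order.hasTop.Build Order.SetSubsetOrder.subset_display (congruence L) con_le_top.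

Definition con_rel t : rel L := fun a b => (a, b) \in con_set t.

Lemma con_equiv_subproof t : equiv_class_of (con_rel t).
Proof.
have /is_congruenceP[h1 h2 h3 _] := valP t.
split; first exact: h1.
- by move=> a b; apply/idP/idP; apply: h2.
- by move=> b a c; apply: h3.
Qed.

Canonical con_equiv t := EquivRelPack (con_equiv_subproof t).

End CongruenceLattice.

Arguments con_gen {d L} G.

Section Quotient.
Context {d : Order.disp_t} {L : finLatticeType d}.
Variable t : congruence L.

Definition quotient_lattice := {eq_quot (con_equiv t)}%qT.

HB.instance Definition _ := Choice.on quotient_lattice.
HB.instance Definition _ := EqQuotient.on quotient_lattice.

Implicit Types X Y Z : quotient_lattice.

Local Notation pi := (\pi_quotient_lattice)%qT.

Definition quo_meet X Y : quotient_lattice := pi (repr X `&` repr Y).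
Definition quo_join X Y : quotient_lattice := pi (repr X `|` repr Y).

Lemma quo_eqE a b : (pi a = pi b) <-> (a, b) \in con_set t.
Proof. by split=> [/eqquotP|h]; last exact/eqquotP. Qed.

Lemma repr_pi a : (repr (pi a), a) \in con_set t.
Proof. by apply/quo_eqE; rewrite reprK. Qed.

Lemma quo_meetE a b : quo_meet (pi a) (pi b) = pi (a `&` b).
Proof.
have /is_congruenceP[_ _ _ h4] := valP t.
by apply/quo_eqE; apply: (h4 _ _ _ _ (repr_pi a) (repr_pi b)).1.
Qed.

Lemma quo_joinE a b : quo_join (pi a) (pi b) = pi (a `|` b).
Proof.
have /is_congruenceP[_ _ _ h4] := valP t.
by apply/quo_eqE; apply: (h4 _ _ _ _ (repr_pi a) (repr_pi b)).2.
Qed.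

Definition quo_le X Y : bool := quo_meet X Y == X.

Lemma quo_meetC : commutative quo_meet.
Proof. by elim/quotW=> a; elim/quotW=> b; rewrite !quo_meetE meetC. Qed.

Lemma quo_joinC : commutative quo_join.
Proof. by elim/quotW=> a; elim/quotW=> b; rewrite !quo_joinE joinC. Qed.

Lemma quo_meetA : associative quo_meet.
Proof.
elim/quotW=> a; elim/quotW=> b; elim/quotW=> c.
by rewrite (quo_meetE b c) (quo_meetE a b) !(quo_meetE _ _) meetA.
Qed.

Lemma quo_joinA : associative quo_join.
Proof.
elim/quotW=> a; elim/quotW=> b; elim/quotW=> c.
by rewrite (quo_joinE b c) (quo_joinE a b) !(quo_joinE _ _) joinA.
Qed.

Lemma quo_joinKI Y X : quo_meet X (quo_join X Y) = X.
Proof.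
by elim/quotW: X => a; elim/quotW: Y => b; rewrite quo_joinE quo_meetE joinKI.
Qed.

Lemma quo_meetKU Y X : quo_join X (quo_meet X Y) = X.
Proof.
by elim/quotW: X => a; elim/quotW: Y => b; rewrite quo_meetE quo_joinE meetKU.
Qed.

Lemma quo_le_refl : reflexive quo_le.
Proof. by elim/quotW=> a; rewrite /quo_le quo_meetE meetxx. Qed.

Lemma quo_le_anti : antisymmetric quo_le.
Proof. by move=> X Y /andP[/eqP XY /eqP YX]; rewrite -{}XY quo_meetC. Qed.

Lemma quo_le_trans : transitive quo_le.
Proof.
move=> Y X Z /eqP XY /eqP YZ; apply/eqP.
by rewrite -[in LHS]XY -quo_meetA YZ.
Qed.

HB.instance Definition _ :=
  Order.Le_isPOrder.Build d quotient_lattice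
    quo_le_refl quo_le_anti quo_le_trans.

Lemma quo_leEmeet X Y : (X <= Y) = (quo_meet X Y == X).
Proof. by []. Qed.

HB.instance Definition _ :=
  Order.POrder_isLattice.Build d quotient_lattice
    quo_meetC quo_joinC quo_meetA quo_joinA quo_joinKI quo_meetKU quo_leEmeet.

End Quotient.

(* Permutohedra.  The index set [n] is 'I_n.+1 without 0, so that labels     *)
(* run from 1 to n.                                                          *)

Section Permutohedron.
Variable n : nat.

Local Notation T := ('I_n.+1 * 'I_n.+1)%type.
Implicit Types (x y z : {set T}) (i j k : 'I_n.+1).

Definition pairs_lt : {set T} := [set p : T | (0 < p.1)%N && (p.1 < p.2)%N].

Definition is_closed x : bool :=
  [forall i, forall j, forall k,
     ((i, j) \in x) && ((j, k) \in x) ==> ((i, k) \in x)].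

Definition is_clopen x : bool :=
  [&& x \subset pairs_lt, is_closed x & is_closed (pairs_lt :\: x)].

Lemma is_closedP x :
  reflect (forall i j k, (i, j) \in x -> (j, k) \in x -> (i, k) \in x)
          (is_closed x).
Proof.
apply: (iffP idP) => [h i j k ij jk|h].
  move/forallP/(_ i)/forallP/(_ j)/forallP/(_ k)/implyP: h; apply.
  by rewrite ij.
apply/forallP => i; apply/forallP => j; apply/forallP => k.
by apply/implyP => /andP[]; apply: h.
Qed.

Record permutohedron :=
  Permutohedron { inv_set :> {set T}; _ : is_clopen inv_set }.

HB.instance Definition _ := [isSub for inv_set].
HB.instance Definition _ := [Finite of permutohedron by <:].

Implicit Types a b c : permutohedron.

Definition perm_le a b : bool := inv_set a \subset inv_set b.

Lemma perm_le_refl : reflexive perm_le.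
Proof. by move=> a; apply: subxx. Qed.

Lemma perm_le_anti : antisymmetric perm_le.
Proof. by move=> a b ab; apply/val_inj/eqP; rewrite eqEsubset. Qed.

Lemma perm_le_trans : transitive perm_le.
Proof. by move=> b a c; apply: subset_trans. Qed.

HB.instance Definition _ :=
  Order.Le_isPOrder.Build Order.SetSubsetOrder.subset_display permutohedron
    perm_le_refl perm_le_anti perm_le_trans.

Definition set_rel x : rel 'I_n.+1 := fun i j => (i, j) \in x.

Definition tclosure x : {set T} :=
  [set p in pairs_lt | connect (set_rel x) p.1 p.2].

Lemma tclosure_min x z :
  is_closed z -> x \subset z -> tclosure x \subset z.
Proof.
move=> /is_closedP zc /subsetP xz; apply/subsetP => -[i k].
rewrite !inE /= => /andP[/andP[_ ik] /connectP[p pth def_k]].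
have {ik} : i != k by rewrite neq_ltn ik.
elim: p i pth def_k => [|j p IHp] i /=; first by move=> _ ->; rewrite eqxx.
case/andP=> /xz ij pth def_k _.
have [<- //|jk] := eqVneq j k.
by apply: zc ij _; apply: IHp.
Qed.

Lemma sub_tclosure x : x \subset pairs_lt -> x \subset tclosure x.
Proof.
move/subsetP => xI; apply/subsetP => -[i j] ij.
by rewrite inE xI //=; apply: connect1.
Qed.

Lemma clopen_open x i j k : is_clopen x -> (i, k) \in x ->
  (i < j)%N -> (j < k)%N -> ((i, j) \in x) || ((j, k) \in x).
Proof.
move=> /and3P[/subsetP xI _ /is_closedP xo] ik ij jk.
apply: contraLR (ik); rewrite negb_or => /andP[nij njk].
have := xI _ ik; rewrite inE /= => /andP[i0 _].
have := xo i j k; rewrite !inE nij njk /= i0 ij jk /= (leq_trans i0 (ltnW ij)).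
by move=> /(_ isT isT)/andP[].
Qed.

Lemma tclosureU_clopen x y :
  is_clopen x -> is_clopen y -> is_clopen (tclosure (x :|: y)).
Proof.
move=> cx cy.
have sub : x :|: y \subset pairs_lt.
  by rewrite subUset; case/and3P: cx => ->; case/and3P: cy => ->.
have stepE i k j : set_rel (x :|: y) i k -> (i < j)%N -> (j < k)%N ->
    set_rel (x :|: y) i j || set_rel (x :|: y) j k.
  rewrite /set_rel !inE => /orP[]ik ij jk.
    by have /orP[->|->] := clopen_open cx ik ij jk; rewrite ?orbT.
  by have /orP[->|->] := clopen_open cy ik ij jk; rewrite ?orbT.
apply/and3P; split.
- by apply/subsetP => p; rewrite inE => /andP[].
- apply/is_closedP => i j k; rewrite !inE /=.
  move=> /andP[/andP[i0 ij] cij] /andP[/andP[_ jk] cjk].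
  by rewrite i0 (ltn_trans ij jk) (connect_trans cij cjk).
- have key i j k : (i < j)%N -> (j < k)%N ->
      connect (set_rel (x :|: y)) i k ->
      connect (set_rel (x :|: y)) i j || connect (set_rel (x :|: y)) j k.
    move=> ij jk /connectP[p pth def_k].
    elim: p i pth def_k ij => [|l p IHp] i /=.
      by move=> _ ek ij; move: (ltn_trans ij jk); rewrite ek ltnn.
    case/andP=> il pth def_k ij.
    have lk : connect (set_rel (x :|: y)) l k by apply/connectP; exists p.
    have [jl|lj|/val_inj ->] := ltngtP j l; last by rewrite (connect1 il).
    - have /orP[h|h] := stepE _ _ _ il ij jl; first by rewrite (connect1 h).
      by rewrite (connect_trans (connect1 h) lk) orbT.
    - have /orP[h|->] := IHp l pth def_k lj; last by rewrite orbT.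
      by rewrite (connect_trans (connect1 il) h).
  apply/is_closedP => i j k; rewrite !inE /=.
  move=> /andP[nij /andP[i0 ij]] /andP[njk /andP[j0 jk]].
  rewrite i0 (ltn_trans ij jk) !andbT /=.
  apply/negP => /(key _ _ _ ij jk).
  by move: nij njk; rewrite i0 j0 ij jk /= => /negPf-> /negPf->.
Qed.

Lemma clopenC x : is_clopen x -> is_clopen (pairs_lt :\: x).
Proof.
case/and3P=> xI xc xo; apply/and3P; split=> //; first exact: subsetDl.
by rewrite setDDr setDv set0U (setIidPr xI).
Qed.

Definition perm_compl a : permutohedron := Permutohedron (clopenC (valP a)).

Definition perm_join a b : permutohedron :=
  Permutohedron (tclosureU_clopen (valP a) (valP b)).

Definition perm_meet a b : permutohedron :=
  perm_compl (perm_join (perm_compl a) (perm_compl b)).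

Lemma perm_joinP a b c : (perm_join a b <= c) = (a <= c) && (b <= c).
Proof.
have /and3P[aI _ _] := valP a; have /and3P[bI _ _] := valP b.
have /and3P[_ cc _] := valP c.
rewrite -[RHS]subUset; apply/idP/idP => [|h]; last exact: tclosure_min.
by apply: subset_trans; apply: sub_tclosure; rewrite subUset aI.
Qed.

Lemma perm_complK : involutive perm_compl.
Proof.
move=> a; apply/val_inj; rewrite /= setDDr setDv set0U; apply/setIidPr.
by have /and3P[] := valP a.
Qed.

Lemma perm_compl_anti a b : (a <= b) -> (perm_compl b <= perm_compl a).
Proof. exact: setDS. Qed.

Lemma perm_compl_swap a b : (a <= perm_compl b) = (b <= perm_compl a).
Proof.
by apply/idP/idP => /perm_compl_anti; rewrite perm_complK.
Qed.

Lemma perm_meetP a b c : (a <= perm_meet b c) = (a <= b) && (a <= c).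
Proof.
rewrite [LHS]perm_compl_swap perm_joinP.
by rewrite !(perm_compl_swap _ a) !perm_complK.
Qed.

HB.instance Definition _ :=
  Order.POrder_MeetJoin_isLattice.Build Order.SetSubsetOrder.subset_display permutohedron
    perm_meetP perm_joinP.

Lemma is_clopen_simple i j :
  (0 < i)%N -> j = i.+1 :> nat -> is_clopen [set (i, j)].
Proof.
move=> i0 ij; apply/and3P; split.
- by apply/subsetP => p; rewrite !inE => /eqP->; rewrite /= i0 ij ltnSn.
- apply/is_closedP => a b c; rewrite !inE !xpair_eqE -!val_eqE /=; lia.
- apply/is_closedP => a b c; rewrite !inE !xpair_eqE -!val_eqE /=; lia.
Qed.

Lemma is_clopen_upper i j k :
  (0 < i)%N -> j = i.+1 :> nat -> k = i.+2 :> nat ->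
  is_clopen [set (j, k); (i, k)].
Proof.
move=> i0 ij ik; apply/and3P; split.
- by apply/subsetP => -[a b]; rewrite !inE !xpair_eqE -!val_eqE /=; lia.
- apply/is_closedP => a b c; rewrite !inE !xpair_eqE -!val_eqE /=; lia.
- apply/is_closedP => a b c; rewrite !inE !xpair_eqE -!val_eqE /=; lia.
Qed.

Lemma is_clopen_lower i j k :
  (0 < i)%N -> j = i.+1 :> nat -> k = i.+2 :> nat ->
  is_clopen [set (i, j); (i, k)].
Proof.
move=> i0 ij ik; apply/and3P; split.
- by apply/subsetP => -[a b]; rewrite !inE !xpair_eqE -!val_eqE /=; lia.
- apply/is_closedP => a b c; rewrite !inE !xpair_eqE -!val_eqE /=; lia.
- apply/is_closedP => a b c; rewrite !inE !xpair_eqE -!val_eqE /=; lia.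
Qed.

(* The sets involved are clopen by is_clopen_simple, is_clopen_upper and     *)
(* is_clopen_lower, so that every admissible i does contribute a pair.       *)
Definition cambrian_pairs (U : {set 'I_n.+1}) :
  {set permutohedron * permutohedron} :=
  [set p | [exists i : 'I_n.+1,
     let j : 'I_n.+1 := inord i.+1 in
     let k : 'I_n.+1 := inord i.+2 in
     [&& (1 <= i)%N, (i <= n - 2)%N &
       if j \in U
       then (inv_set p.1 == [set (j, k)]) &&
            (inv_set p.2 == [set (j, k); (i, k)])
       else (inv_set p.1 == [set (i, j)]) &&
            (inv_set p.2 == [set (i, j); (i, k)])]]].

Definition cambrian_congruence (U : {set 'I_n.+1}) : congruence permutohedron :=
  con_gen (cambrian_pairs U).

End Permutohedron.

(* Main.v *)
(* For a < c and a set V of labels, perm_arc V a c is the join-irreducible     *)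
(* element <a,c;V> of P(n). Since x is the join of the arcs below it, one may  *)
(* compare elements through arcs: arc_con V a c identifies x and y when the    *)
(* same arcs <i,k;V> with a <= i < k <= c lie below both. It is the largest    *)
(* congruence that does not collapse <a,c;V>, that is, does not relate it to   *)
(* an element strictly below it. A congruence that collapses <i,k;V> collapses *)
(* <a,c;V> for every larger interval: join with all pairs inside [a,i] and     *)
(* inside [k,c]. Hence every congruence is the intersection of the arc_con     *)
(* above it, so the meet-irreducible congruences are the arc_con V a c, and    *)
(* the minimal ones those with a = 1, c = n. The generators of eta_U collapse  *)
(* <b-1,b+1;V> exactly when V and U differ at b, so arc_con V a c contains     *)
(* eta_U iff V and U agree on ]a,c[; therefore eta_U = arc_con U 1 n.          *)

Require Import Defs.
From mathcomp Require Import all_boot all_order zify.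

Set Implicit Arguments.
Unset Strict Implicit.
Unset Printing Implicit Defensive.

Import Order.TTheory.
Local Open Scope order_scope.

(** Arcs serve as test elements for congruences. The delicate point about [arc_con] is compatibility
    with joins ([arc_le_join]): an arc below a join is cut, at a pair supplied by one of the two
    joinands, into shorter arcs with the same V. By [collapses_nle] and [arc_con_ncollapses], for 0
    < a < c a congruence lies below [arc_con V a c] iff it does not collapse <a,c;V>, and
    [congr_le_arc_con] recovers a congruence from the arcs it collapses, by induction on their
    length.

    With [arc_con_meet_irreducible] this lists the meet-irreducible congruences. Lengthening the
    interval shrinks [arc_con] ([arc_con_le]), and [cambrian_arc_con] identifies those on the full
    interval with the Cambrian congruences. So for each n the two families of congruences are the
    same, and no isomorphism of quotients has to be built. *)

(** * Generalities on congruences and meet-irreducible elements *)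

Section CongruenceFacts.
Context {d : Order.disp_t} {L : finLatticeType d}.
Implicit Types (t : congruence L) (a b c : L).

Lemma congr_refl t a : (a, a) \in con_set t.
Proof. by have /is_congruenceP[] := valP t. Qed.

Lemma congr_sym t a b : (a, b) \in con_set t -> (b, a) \in con_set t.
Proof. by have /is_congruenceP[_ h _ _] := valP t; apply: h. Qed.

Lemma congr_trans t a b c :
  (a, b) \in con_set t -> (b, c) \in con_set t -> (a, c) \in con_set t.
Proof. by have /is_congruenceP[_ _ h _] := valP t; apply: h. Qed.

Lemma congr_meet t a a' b b' : (a, a') \in con_set t ->
  (b, b') \in con_set t -> (a `&` b, a' `&` b') \in con_set t.
Proof. by have /is_congruenceP[_ _ _ h] := valP t => aa /(h _ _ _ _ aa)[]. Qed.

Lemma congr_join t a a' b b' : (a, a') \in con_set t ->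
  (b, b') \in con_set t -> (a `|` b, a' `|` b') \in con_set t.
Proof. by have /is_congruenceP[_ _ _ h] := valP t => aa /(h _ _ _ _ aa)[]. Qed.

Lemma congr_leP t (u : congruence L) :
  reflect (forall a b, (a, b) \in con_set t -> (a, b) \in con_set u) (t <= u).
Proof.
apply: (iffP (subsetP (A := mem (con_set t)) (B := mem (con_set u)))).
  by move=> h a b; apply: h.
by move=> h [a b]; apply: h.
Qed.

Lemma sub_con_gen (G : {set L * L}) : G \subset con_set (con_gen G).
Proof. by rewrite -con_gen_min; apply: subxx. Qed.

End CongruenceFacts.

Lemma meet_irreducible_bigmeet d (L : tbLatticeType d) (x : L) (I : Type)
    (r : seq I) (p : pred I) (f : I -> L) :
  meet_irreducible x -> x = \meet_(i <- r | p i) f i ->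
  exists2 i, p i & x = f i.
Proof.
move=> [xT xI]; elim: r => [|i r IH]; first by rewrite big_nil.
rewrite big_cons; case: ifP => // pi xE.
have [xi|nxi] := eqVneq x (f i); first by exists i.
have [/IH//|nxr] := eqVneq x (\meet_(i <- r | p i) f i).
case: xI; exists (f i), (\meet_(i <- r | p i) f i).
by split=> //; rewrite lt_neqAle (nxi, nxr) /= {1}xE (leIl, leIr).
Qed.

(** * Arcs *)

Section Arcs.
Context {n : nat}.

Local Notation P := (permutohedron n).
Implicit Types (x y z : P) (i j k l a b c s t p q r u : 'I_n.+1) (V W : {set 'I_n.+1}).

Lemma inv_lt x i k : (i, k) \in inv_set x -> (0 < i)%N && (i < k)%N.
Proof. by have /and3P[/subsetP h _ _] := valP x => /h; rewrite inE. Qed.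

Lemma inv_trans x i j k :
  (i, j) \in inv_set x -> (j, k) \in inv_set x -> (i, k) \in inv_set x.
Proof. by have /and3P[_ /is_closedP h _] := valP x; apply: h. Qed.

Lemma inv_split x i j k : (i, k) \in inv_set x -> (i < j)%N -> (j < k)%N ->
  (i, j) \in inv_set x \/ (j, k) \in inv_set x.
Proof. by move=> ik ij jk; apply/orP; apply: clopen_open ik ij jk; apply: valP. Qed.

Lemma perm_leP x y :
  reflect (forall i k, (i, k) \in inv_set x -> (i, k) \in inv_set y) (x <= y).
Proof.
apply: (iffP (subsetP (A := mem (inv_set x)) (B := mem (inv_set y)))).
  by move=> h i k; apply: h.
by move=> h [i k]; apply: h.
Qed.

Lemma join_sub_closed x y (w : {set 'I_n.+1 * 'I_n.+1}) :
  is_closed w -> inv_set x \subset w -> inv_set y \subset w ->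
  inv_set (x `|` y) \subset w.
Proof. by move=> wc xw yw; apply: tclosure_min => //; rewrite subUset xw. Qed.

(* The join-irreducible element <i,k;V>.                                     *)
Definition arc_set V i k : {set 'I_n.+1 * 'I_n.+1} :=
  [set p in pairs_lt n | [&& (i <= p.1)%N, (p.2 <= k)%N,
     (p.1 == i) || (p.1 \notin V) & (p.2 == k) || (p.2 \in V)]].

Lemma in_arc_set V i k s t : ((s, t) \in arc_set V i k) =
  [&& (0 < s)%N, (s < t)%N, (i <= s)%N, (t <= k)%N,
      (s == i) || (s \notin V) & (t == k) || (t \in V)].
Proof. by rewrite !inE /= -andbA. Qed.

(** Closure is vacuous: the middle label of a chain would lie strictly between i and k, both in V
    and outside V. For the complement, a pair of the arc split at s keeps its left part if s is in V
    and its right part otherwise. *)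
Lemma arc_set_clopen V i k : is_clopen (arc_set V i k).
Proof.
apply/and3P; split.
- by apply/subsetP => p; rewrite inE => /andP[].
- apply/is_closedP => r s t; rewrite !in_arc_set -!val_eqE /=.
  by case: (s \in V) => /=; lia.
- apply/is_closedP => r s t; rewrite !inE /= -!val_eqE /=.
  by case: (s \in V) => /=; lia.
Qed.

Definition perm_arc V i k : P := Permutohedron (arc_set_clopen V i k).

Lemma in_arc V i k s t : ((s, t) \in inv_set (perm_arc V i k)) =
  [&& (0 < s)%N, (s < t)%N, (i <= s)%N, (t <= k)%N,
      (s == i) || (s \notin V) & (t == k) || (t \in V)].
Proof. exact: in_arc_set. Qed.

Lemma arc_nochain V i k p q r :
  (p, q) \in inv_set (perm_arc V i k) -> (q, r) \notin inv_set (perm_arc V i k).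
Proof. by rewrite !in_arc -!val_eqE /=; case: (q \in V) => /=; lia. Qed.

Lemma arc_ends V i k : (0 < i)%N -> (i < k)%N -> (i, k) \in inv_set (perm_arc V i k).
Proof. by rewrite in_arc !eqxx !leqnn => -> ->. Qed.

Lemma arc_le V i k a c : (a, c) \in inv_set (perm_arc V i k) -> perm_arc V a c <= perm_arc V i k.
Proof.
move=> ac; apply/perm_leP => s t; move: ac; rewrite !in_arc.
case: (eqVneq s a) => [->|_]; case: (eqVneq t c) => [->|_] /=; lia.
Qed.

Lemma arc_ext V W i k :
  (forall j, (i < j)%N -> (j < k)%N -> (j \in V) = (j \in W)) ->
  perm_arc V i k = perm_arc W i k.
Proof.
move=> VW; apply/val_inj/setP => -[s t]; rewrite !in_arc_set.
have := VW s; have := VW t; rewrite -!val_eqE /=.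
by case: (s \in V); case: (t \in V); case: (s \in W); case: (t \in W) => /=; lia.
Qed.

(** This is join-irreducibility: everything strictly below the arc omits the pair (i,k). When (i,k)
    is split at j, only one of the two parts belongs to the arc, so membership of j in V forces
    which part y contains. *)
Lemma arc_below V i k y :
  y <= perm_arc V i k -> (i, k) \in inv_set y -> perm_arc V i k <= y.
Proof.
move=> /perm_leP yJ ik; have /andP[i0 _] := inv_lt ik.
have L j : (i < j)%N -> (j < k)%N -> j \in V -> (i, j) \in inv_set y.
  move=> ij jk jV; have [//|/yJ] := inv_split ik ij jk.
  by rewrite in_arc jV -val_eqE /=; lia.
have R j l : (i < j)%N -> (j < l)%N -> j \notin V -> (i, l) \in inv_set y ->
    (j, l) \in inv_set y.
  move=> ij jl jV il; have [/yJ|//] := inv_split il ij jl.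
  move: (yJ _ _ il); rewrite !in_arc (negPf jV) -!val_eqE /=; lia.
apply/perm_leP => s t; rewrite in_arc => /and5P[s0 st les tk] /andP[sV tV].
have it : (i, t) \in inv_set y.
  case/orP: tV => [/eqP-> //|tV]; have [/ord_inj -> //|ne] := eqVneq (nat_of_ord t) k.
  by apply: L => //; lia.
case/orP: sV => [/eqP-> //|sV].
by have [/ord_inj -> //|ne] := eqVneq (nat_of_ord s) i; apply: R it => //; lia.
Qed.

(** Every pair of x is the long pair of an arc below x, so x is the join of its arcs; V is read off
    from the row of a in x. *)
Lemma arc_inv_le x a c : (a, c) \in inv_set x ->
  perm_arc [set b | (a, b) \in inv_set x] a c <= x.
Proof.
move=> ac; apply/perm_leP => s t; rewrite in_arc !inE.
move=> /and5P[s0 st as_ tc] /andP[sV tV].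
have at_ : (a, t) \in inv_set x by case/orP: tV => [/eqP->|].
case/orP: sV => [/eqP-> //|sV].
have [/ord_inj -> //|ne] := eqVneq (nat_of_ord s) a.
by have [h|//] := inv_split (j := s) at_ ltac:(lia) st; rewrite h in sV.
Qed.

Lemma arc_cat V i j k z : (i <= j)%N -> (j <= k)%N ->
  perm_arc V i j <= z -> perm_arc V j k <= z -> perm_arc V i k <= z.
Proof.
move=> ij jk /perm_leP h1 /perm_leP h2; apply/perm_leP => s t.
rewrite in_arc => st.
have [tj|jt] := leqP t j.
  by apply: h1; rewrite in_arc; move: st; rewrite -!val_eqE /=; lia.
have [js|sj] := leqP j s.
  by apply: h2; rewrite in_arc; move: st; rewrite -!val_eqE /=; lia.
apply: (inv_trans (j := j)).
  by apply: h1; rewrite in_arc; move: st; rewrite -!val_eqE /=; lia.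
by apply: h2; rewrite in_arc; move: st; rewrite -!val_eqE /=; lia.
Qed.

(* The shortest pair of x whose ends are of this kind spans an perm_arc of x.     *)
Lemma arc_refine V x s t : (s, t) \in inv_set x ->
  exists s' t', [/\ (s <= s' < t')%N, (t' <= t)%N,
    (s' == s) || (s' \in V), (t' == t) || (t' \notin V) & perm_arc V s' t' <= x].
Proof.
move: {2}(t - s)%N (leqnn (t - s)) => m.
elim: m s t => [|m IH] s t tsm st; have /andP[s0 lst] := inv_lt st; first lia.
(* Either an inner label c gives a shorter pair of x with ends of the right kind, and induction
   applies, or every split of (s,t) goes the way the arc requires. *)
have [/existsP[c /and3P[sc ct cV]]|/existsPn noc] := boolP [exists c : 'I_n.+1,
   [&& (s < c)%N, (c < t)%N &
       (if c \in V then (c, t) \in inv_set x else (s, c) \in inv_set x)]].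
  case: ifP cV => cV /IH[|s' [t' [h1 h3 h4 h5 h6]]]; try lia;
    exists s', t'; split => //; try lia.
  - by case/orP: h4 => [/eqP->|->]; rewrite ?cV orbT.
  - by case/orP: h5 => [/eqP->|->]; rewrite ?cV orbT.
have L c : (s < c)%N -> (c < t)%N -> c \in V -> (s, c) \in inv_set x.
  move=> sc ct cV; have [//|h] := inv_split st sc ct.
  by have := noc c; rewrite sc ct cV h.
have R c u : (s < c)%N -> (c < u)%N -> (u <= t)%N -> c \notin V ->
   (s, u) \in inv_set x -> (c, u) \in inv_set x.
  move=> sc cu ut cV su; have [h|//] := inv_split su sc cu.
  by have := noc c; rewrite sc (negPf cV) h (leq_trans cu ut).
exists s, t; split; rewrite ?eqxx ?leqnn //; apply/perm_leP => p q.
rewrite in_arc => /and5P[p0 pq sp qt] /andP[pV qV].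
have sq : (s, q) \in inv_set x.
  case/orP: qV => [/eqP-> //|qV]; have [/ord_inj -> //|ne] := eqVneq (nat_of_ord q) t.
  by apply: L => //; lia.
case/orP: pV => [/eqP-> //|pV].
by have [/ord_inj -> //|ne] := eqVneq (nat_of_ord p) s; apply: R sq => //; lia.
Qed.

(** Used with x' and y' congruent to x and y, this makes [arc_con] compatible with joins. The
    hypotheses only mention arcs inside [i,k] with the same V, which is what allows induction on the
    length. *)
Lemma arc_le_join V x y x' y' i k :
  (forall s t, (0 < s)%N -> (i <= s)%N -> (s < t)%N -> (t <= k)%N ->
     perm_arc V s t <= x -> perm_arc V s t <= x') ->
  (forall s t, (0 < s)%N -> (i <= s)%N -> (s < t)%N -> (t <= k)%N ->
     perm_arc V s t <= y -> perm_arc V s t <= y') ->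
  (0 < i)%N -> (i < k)%N -> perm_arc V i k <= x `|` y -> perm_arc V i k <= x' `|` y'.
Proof.
move: {2}(k - i)%N (leqnn (k - i)) => m.
elim: m i k => [|m IH] i k kim hx hy i0 ik Jxy; first lia.
(* E has the end conditions opposite to those of the arc. Its complement is closed: if (r,t) is in E
   and r < s < t, then (s,t) or (r,s) is in E according to whether s is in V. As (i,k) is in E and
   in the join, x or y must meet E; [arc_refine] turns the common pair into an arc. *)
pose E := [set p : 'I_n.+1 * 'I_n.+1 | [&& (i <= p.1)%N, (p.2 <= k)%N,
  (p.1 == i) || (p.1 \in V) & (p.2 == k) || (p.2 \notin V)]].
have [s [t [les st tk sV [tV Jst]]]] : exists s t, [/\ (i <= s)%N, (s < t)%N,
    (t <= k)%N, (s == i) || (s \in V) & ((t == k) || (t \notin V)) /\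
    perm_arc V s t <= x' `|` y'].
  have key (v v' : P) : (forall s t, (0 < s)%N -> (i <= s)%N -> (s < t)%N ->
      (t <= k)%N -> perm_arc V s t <= v -> perm_arc V s t <= v') -> v' <= x' `|` y' ->
      ~~ (inv_set v \subset pairs_lt n :\: E) -> exists s t, [/\ (i <= s)%N,
    (s < t)%N, (t <= k)%N, (s == i) || (s \in V) & ((t == k) || (t \notin V)) /\
    perm_arc V s t <= x' `|` y'].
    move=> hv vxy /subsetPn[[s t] st]; have /andP[s0 lst] := inv_lt st.
    rewrite !inE /= s0 lst !andbT negbK => /and4P[les tk sV tV].
    have [s' [t' [h1 h3 h4 h5 h6]]] := arc_refine V st.
    case/andP: h1 => h1 h2; have is' := leq_trans les h1.
    have tk' := leq_trans h3 tk; exists s', t'; split => //.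
    - by case/orP: h4 => [/eqP->|->]; rewrite ?orbT.
    - split; first by case/orP: h5 => [/eqP->|->]; rewrite ?orbT.
      apply: le_trans vxy; apply: hv h6 => //; exact: leq_trans s0 h1.
  have [xw|nw] := boolP (inv_set x \subset pairs_lt n :\: E); last first.
    exact: key hx (leUl _ _) nw.
  have [yw|nw] := boolP (inv_set y \subset pairs_lt n :\: E); last first.
    exact: key hy (leUr _ _) nw.
  have wc : is_closed (pairs_lt n :\: E).
    apply/is_closedP => r s t; rewrite !inE /= -!val_eqE /=.
    by case: (s \in V) => /=; lia.
  have /subsetP/(_ (i, k)) := join_sub_closed wc xw yw.
  move/perm_leP: Jxy => /(_ i k) -> => [/(_ isT)|]; last exact: arc_ends.
  by rewrite !inE /= !leqnn !eqxx.
(* The remaining pieces <i,s;V> and <t,k;V> lie below the original arc because s is in V and t is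
   not; induction handles them and [arc_cat] glues. *)
have IH' a c : (i <= a)%N -> (a < c)%N -> (c <= k)%N -> (c - a < k - i)%N ->
    (a, c) \in inv_set (perm_arc V i k) -> perm_arc V a c <= x' `|` y'.
  move=> ia ac ck lt acJ; apply: IH => //.
  - by rewrite -ltnS; apply: leq_trans lt kim.
  - by move=> p q p0 /(leq_trans ia) ip pq qc; apply: hx (leq_trans qc ck).
  - by move=> p q p0 /(leq_trans ia) ip pq qc; apply: hy (leq_trans qc ck).
  - exact: leq_trans i0 ia.
  - exact: le_trans (arc_le acJ) Jxy.
have Jit : perm_arc V i t <= x' `|` y'.
  case/orP: sV => [/eqP<- //|sV].
  have [/ord_inj <- //|ne] := eqVneq (nat_of_ord s) i.
  apply: (arc_cat (j := s)) => //; first lia.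
  by apply: IH'; try lia; rewrite in_arc sV -!val_eqE /=; lia.
case/orP: tV => [/eqP<- //|tV].
have [/ord_inj <- //|ne] := eqVneq (nat_of_ord t) k.
apply: (arc_cat (j := t)) => //; first lia.
by apply: IH'; try lia; rewrite in_arc tV -!val_eqE /=; lia.
Qed.

(** * The congruences [arc_con] *)

Definition arc_con_set V a c : {set P * P} :=
  [set p | [forall i : 'I_n.+1, forall k : 'I_n.+1,
     [&& (0 < i)%N, (a <= i)%N, (i < k)%N & (k <= c)%N] ==>
     ((perm_arc V i k <= p.1) == (perm_arc V i k <= p.2))]].

Lemma arc_con_setP V a c x y :
  reflect (forall i k, (0 < i)%N -> (a <= i)%N -> (i < k)%N -> (k <= c)%N ->
             (perm_arc V i k <= x) = (perm_arc V i k <= y))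
          ((x, y) \in arc_con_set V a c).
Proof.
rewrite inE; apply: (iffP forallP) => h i.
  by move=> k i0 ai ik kc; have /forallP/(_ k) := h i; rewrite i0 ai ik kc => /eqP.
by apply/forallP => k; apply/implyP => /and4P[i0 ai ik kc]; rewrite /= h.
Qed.

Lemma arc_con_subproof V a c : is_congruence (arc_con_set V a c).
Proof.
apply/is_congruenceP; split.
- by move=> x; apply/arc_con_setP.
- by move=> x y /arc_con_setP h; apply/arc_con_setP => *; rewrite h.
- move=> x y z /arc_con_setP h /arc_con_setP h'.
  by apply/arc_con_setP => *; rewrite h // h'.
move=> x x' y y' /arc_con_setP hx /arc_con_setP hy.
split; apply/arc_con_setP => i k i0 ai ik kc.
  by rewrite !lexI hx ?hy.
by apply/idP/idP; apply: arc_le_join => // s t s0 les st tk;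
  rewrite ?hx ?hy //; lia.
Qed.

Definition arc_con V a c : congruence P := Congruence (arc_con_subproof V a c).

Lemma arc_conP V a c x y :
  reflect (forall i k, (0 < i)%N -> (a <= i)%N -> (i < k)%N -> (k <= c)%N ->
             (perm_arc V i k <= x) = (perm_arc V i k <= y))
          ((x, y) \in con_set (arc_con V a c)).
Proof. exact: arc_con_setP. Qed.

End Arcs.

(** * Congruences and the arcs they collapse *)

Section ArcCongruences.
Context {n : nat}.

Local Notation P := (permutohedron n).
Implicit Types (x y z v w : P) (i j k l a b c p q : 'I_n.+1).
Implicit Types (V U : {set 'I_n.+1}) (s t : congruence P).

(** For 0 < a < c, omitting (a,c) amounts to lying strictly below the arc, by [arc_below]. *)
Definition collapses t V a c : Prop :=
  exists y, [/\ (a, c) \notin inv_set y, y <= perm_arc V a c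
              & (perm_arc V a c, y) \in con_set t].

Lemma collapses_of_pair t V i k x y : (x, y) \in con_set t ->
  perm_arc V i k <= x -> ~~ (perm_arc V i k <= y) -> collapses t V i k.
Proof.
move=> xy Jx nJy; exists (perm_arc V i k `&` y); split; last 2 first.
- exact: leIl.
- by rewrite -{1}(meet_idPl Jx); apply: congr_meet => //; apply: congr_refl.
apply: contra nJy => /(arc_below (leIl _ _)) h; exact: le_trans h (leIr _ _).
Qed.

(** A pair of the long arc that is not already in z is a chain with at most three links: up to i in
    z, inside [i,k] in the short arc, beyond k in z. *)
Lemma arc_le_joinr V z a i k c :
  (0 < a)%N -> (a <= i)%N -> (i < k)%N -> (k <= c)%N ->
  (forall p q, (0 < p)%N -> (a <= p)%N -> (p < q)%N -> (q <= i)%N ->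
     (p, q) \in inv_set z) ->
  (forall p q, (0 < p)%N -> (p < q)%N -> (k <= p)%N -> (q <= c)%N ->
     (p, q) \in inv_set z) ->
  perm_arc V a c <= perm_arc V i k `|` z.
Proof.
move=> a0 ai ik kc zl zr; set u := _ `|` _.
have /perm_leP zu : z <= u := leUr _ _.
have /perm_leP Ju : perm_arc V i k <= u := leUl _ _.
have i0 := leq_trans a0 ai.
apply/perm_leP => l q; rewrite in_arc => /and5P[l0 lq al qc /andP[lV qV]].
have [qi|iq] := leqP q i; first exact/zu/zl.
have [kl|lk] := leqP k l; first exact/zu/zr.
have step q' : (i < q')%N -> (l < q')%N -> (q' <= k)%N ->
    (q' == k) || (q' \in V) -> (l, q') \in inv_set u.
  move=> iq' lq' q'k q'V; have [li|il] := leqP l i; last first.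
    have lV' : l \notin V.
      by case/orP: lV il => // /eqP->; rewrite ltnNge ai.
    by apply: Ju; rewrite in_arc q'V l0 lq' (ltnW il) q'k lV' orbT.
  have iq'u : (i, q') \in inv_set u.
    by apply: Ju; rewrite in_arc q'V eqxx i0 iq' q'k leqnn.
  have [li'|nli] := eqVneq l i; first by rewrite li'.
  apply: inv_trans iq'u; apply/zu/zl => //.
  by rewrite ltn_neqAle li andbT.
have [qk|kq] := leqP q k.
  apply: step => //; case/orP: qV => [/eqP qE|->]; last by rewrite orbT.
  by rewrite -val_eqE eqn_leq /= qk qE kc.
apply: (inv_trans (j := k)); first by apply: step; rewrite ?eqxx.
by apply/zu/zr => //; apply: ltn_trans i0 ik.
Qed.

Lemma collapses_spread t V a i k c :
  (0 < a)%N -> (a <= i)%N -> (i < k)%N -> (k <= c)%N ->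
  collapses t V i k -> collapses t V a c.
Proof.
move=> a0 ai ik kc [y [nik /perm_leP yJ Jy]].
pose zs := [set p in pairs_lt n | (a <= p.1)%N && (p.2 <= i)%N ||
                                  (k <= p.1)%N && (p.2 <= c)%N].
have zsE l q : ((l, q) \in zs) = [&& (0 < l)%N, (l < q)%N &
    (a <= l)%N && (q <= i)%N || (k <= l)%N && (q <= c)%N].
  by rewrite !inE /= -andbA.
have zc : is_clopen zs.
  apply/and3P; split; first by apply/subsetP => p; rewrite inE => /andP[].
  - by apply/is_closedP => l p q; rewrite !zsE; lia.
  - by apply/is_closedP => l p q; rewrite !inE /=; lia.
pose z : P := Permutohedron zc.
have zE l q : ((l, q) \in inv_set z) = [&& (0 < l)%N, (l < q)%N &
    (a <= l)%N && (q <= i)%N || (k <= l)%N && (q <= c)%N] by exact: zsE.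
(* A closed set containing y and z but not (a,c): a chain of w starting at or below i can only leave
   [1,i] towards a label of V strictly between i and k, and no pair of w starts at such a label. *)
pose w := [set p in pairs_lt n |
   ((p.1 <= i)%N ==> (p.2 <= i)%N || (p.2 \in V) && (p.2 < k)%N) &&
   ((i < p.1 < k)%N ==> (p.1 \notin V))].
have wc : is_closed w.
  apply/is_closedP => l p q; rewrite !inE /=.
  by case: (p \in V) => /=; lia.
have nac : (a, c) \notin inv_set (y `|` z).
  apply/negP; have /subsetP h : inv_set (y `|` z) \subset w.
    apply: join_sub_closed => //; apply/subsetP => -[l q].
      move=> lq; have := yJ _ _ lq; rewrite in_arc !inE /=.
      have [/eqP li|nli] := boolP (l == i); have [/eqP qk|nqk] := boolP (q == k).
      + by move: lq nik; rewrite li qk => ->.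
      + by rewrite li; move: nqk; rewrite -!val_eqE /=; lia.
      + by rewrite qk; move: nli; rewrite -!val_eqE /=; lia.
      + by move: nli nqk; rewrite -!val_eqE /=; lia.
    by rewrite zE !inE /=; lia.
  by move/h; rewrite !inE /=; lia.
have Jle : perm_arc V a c <= perm_arc V i k `|` z.
  apply: arc_le_joinr => // p q p0.
    by move=> ap pq qi; rewrite zE p0 pq ap qi.
  by move=> pq kp qc; rewrite zE p0 pq kp qc orbT.
(* The long arc equals its meet with the join of the short arc and z; replace the short arc by y in
   that expression. *)
exists (perm_arc V a c `&` (y `|` z)); split.
- by apply: contra nac => h; have /perm_leP := leIr (y `|` z) (perm_arc V a c); apply.
- exact: leIl.
- rewrite -{1}(meet_idPl Jle); apply: congr_meet; first exact: congr_refl.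
  by apply: congr_join => //; apply: congr_refl.
Qed.

(** A pair of t outside [arc_con V a c] is separated by some arc inside [a,c]. That arc is
    collapsed, and the collapse spreads. *)
Lemma collapses_nle t V a c :
  (0 < a)%N -> ~~ (t <= arc_con V a c) -> collapses t V a c.
Proof.
move=> a0 /subsetPn[[x y] xy]; rewrite inE negb_forall => /existsP[i].
rewrite negb_forall => /existsP[k]; rewrite negb_imply.
move=> /andP[/and4P[i0 ai ik kc] /= ne]; apply: collapses_spread ai ik kc _ => //.
have [Jx|nJx] := boolP (perm_arc V i k <= x).
  by apply: (collapses_of_pair xy Jx); move: ne; rewrite Jx eq_sym eqb_id.
apply: (collapses_of_pair (congr_sym xy) _ nJx).
by move: ne; rewrite (negPf nJx); case: (_ <= y).
Qed.

Lemma arc_con_ncollapses t V a c : (0 < a)%N -> (a < c)%N ->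
  t <= arc_con V a c -> ~ collapses t V a c.
Proof.
move=> a0 ac /congr_leP tle [y [nac _ /tle/arc_conP h]].
have := h a c a0 (leqnn _) ac (leqnn _); rewrite lexx => /esym/perm_leP.
by move=> /(_ a c (arc_ends V a0 ac)); apply/negP.
Qed.

(** In other words, t is the intersection of the [arc_con] above it. *)
Lemma congr_le_arc_con s t :
  (forall V a c, (0 < a)%N -> (a < c)%N ->
     t <= arc_con V a c -> s <= arc_con V a c) -> s <= t.
Proof.
move=> st; suff H x z : (x, z) \in con_set s -> (x `|` z, z) \in con_set t.
  apply/congr_leP => x z xz; apply: congr_trans (H _ _ xz).
  by apply: congr_sym; rewrite joinC; apply/H/congr_sym.
move=> xz.
(* It is enough to absorb into z, modulo t, the arcs of v one by one: their join u is above v, and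
   meeting with the join of v and z concludes. *)
have cover v : (forall a c, (a, c) \in inv_set v ->
    (perm_arc [set b | (a, b) \in inv_set v] a c `|` z, z) \in con_set t) ->
    (v `|` z, z) \in con_set t.
  move=> hv; have [u vu uz] : exists2 u : P, v <= u & (u `|` z, z) \in con_set t.
    suff [u vu uz] : exists2 u : P, {subset enum (inv_set v) <= inv_set u} &
        (u `|` z, z) \in con_set t.
      by exists u => //; apply/perm_leP => a c ac; apply: vu; rewrite mem_enum.
    have : {subset enum (inv_set v) <= inv_set v} by move=> p; rewrite mem_enum.
    elim: (enum _) => [|[a c] r IH] rv.
      by exists z => //; rewrite joinxx; apply: congr_refl.
    have acv : (a, c) \in inv_set v by apply: rv; rewrite mem_head.
    have /andP[a0 ac] := inv_lt acv.
    have [p pr|u ru uz] := IH; first by apply: rv; rewrite inE pr orbT.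
    exists (perm_arc [set b | (a, b) \in inv_set v] a c `|` u).
      move=> [p q]; rewrite inE => /orP[/eqP[-> ->]|/ru pq].
        by have /perm_leP := leUl (perm_arc [set b | (a, b) \in inv_set v] a c) u;
          apply; apply: arc_ends.
      by have /perm_leP := leUr u (perm_arc [set b | (a, b) \in inv_set v] a c); apply.
    by have := congr_join (hv _ _ acv) uz; rewrite joinACA joinxx.
  have := congr_meet uz (congr_refl t (v `|` z)).
  by rewrite (meet_idPr _) ?leU2 // (meet_idPl _) ?leUr.
suff main m V a c : (c - a < m)%N -> (0 < a)%N -> (a < c)%N ->
    perm_arc V a c <= x -> (perm_arc V a c `|` z, z) \in con_set t.
  apply: cover => a c ac; have /andP[a0 lac] := inv_lt ac.
  by apply: (main (c - a).+1) => //; apply: arc_inv_le.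
elim: m V a c => // m IH V a c cam a0 ac Jx.
have [/st-/(_ a0 ac)/congr_leP/(_ _ _ xz)/arc_conP|ntV] :=
    boolP (t <= arc_con V a c).
  move/(_ a c a0 (leqnn _) ac (leqnn _)); rewrite Jx => /esym/join_idPr ->.
  exact: congr_refl.
(* Modulo t the arc may be replaced by y. All pairs of y are strictly shorter than (a,c), so their
   arcs fall under the induction hypothesis. *)
have [y [nac yJ Jy]] := collapses_nle a0 ntV.
apply: congr_trans (congr_join Jy (congr_refl t z)) _.
apply: cover => p q pq; have /andP[p0 lpq] := inv_lt pq.
apply: IH => //; last exact: le_trans (arc_inv_le pq) (le_trans yJ Jx).
have : (p, q) != (a, c) by apply: contraNneq nac => <-.
move/perm_leP: yJ => /(_ _ _ pq); rewrite in_arc xpair_eqE -!val_eqE /=; lia.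
Qed.

(** * Meet-irreducible congruences *)

(** Any strictly larger congruence collapses the arc. If two of them send it to y1 and y2, both
    relate it to the join of y1 and y2, and so does their intersection, which therefore collapses
    the arc as well. *)
Lemma arc_con_meet_irreducible V a c : (0 < a)%N -> (a < c)%N ->
  meet_irreducible (arc_con V a c).
Proof.
move=> a0 ac; have nc t := @arc_con_ncollapses t V a c a0 ac.
split=> [eT|[t1 [t2 [lt1 lt2 tE]]]].
  (* The degenerate arc [perm_arc V c c] is the empty set of pairs. *)
  apply: (nc (arc_con V a c)) => //; exists (perm_arc V c c).
  rewrite eT; split; last exact: in_setT.
    by rewrite in_arc -!val_eqE /=; lia.
  by apply/perm_leP => p q; rewrite in_arc; lia.
have /collapses_nle-/(_ a0)[y1 [n1 l1 h1]] := negbT (lt_geF lt1).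
have /collapses_nle-/(_ a0)[y2 [n2 l2 h2]] := negbT (lt_geF lt2).
have Jl : y1 `|` y2 <= perm_arc V a c by rewrite leUx l1.
have toJ t y : (perm_arc V a c, y) \in con_set t -> y <= y1 `|` y2 ->
    (perm_arc V a c, y1 `|` y2) \in con_set t.
  move=> Jy yy; have := congr_join Jy (congr_refl t (y1 `|` y2)).
  by rewrite (join_idPr yy) (join_idPl Jl).
apply: (nc (arc_con V a c)) => //; exists (y1 `|` y2); split => //.
  (* An arc contains no chain, so removing its long pair leaves a closed set, and the join of y1 and
     y2 still omits (a,c). *)
  have wc : is_closed (inv_set (perm_arc V a c) :\ (a, c)).
    apply/is_closedP => p q r /setD1P[_ pq] /setD1P[_ qr].
    by case/negP: (arc_nochain r pq).
  have sub y : (a, c) \notin inv_set y -> y <= perm_arc V a c ->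
      inv_set y \subset inv_set (perm_arc V a c) :\ (a, c).
    by move=> nac yJ; rewrite subsetD1 nac andbT.
  have /subsetP h := join_sub_closed wc (sub _ n1 l1) (sub _ n2 l2).
  by apply/negP => /h; rewrite !inE eqxx.
have : (perm_arc V a c, y1 `|` y2) \in con_set (t1 `&` t2).
  by rewrite inE (toJ _ _ h1) ?leUl // (toJ _ _ h2) ?leUr.
by rewrite -tE.
Qed.

Lemma meet_irreducible_arc_con t : meet_irreducible t ->
  exists V a c, [/\ (0 < a)%N, (a < c)%N & t = arc_con V a c].
Proof.
move=> tI; pose I := ({set 'I_n.+1} * ('I_n.+1 * 'I_n.+1))%type.
pose pr (p : I) := [&& (0 < p.2.1)%N, (p.2.1 < p.2.2)%N &
                       t <= arc_con p.1 p.2.1 p.2.2].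
have /(meet_irreducible_bigmeet tI)[] :
    t = \meet_(p <- enum {: I} | pr p) arc_con p.1 p.2.1 p.2.2.
  rewrite big_enum_cond; apply/le_anti/andP; split.
    by apply/meetsP => p /andP[_ /and3P[]].
  apply: congr_le_arc_con => V a c a0 ac tV.
  by apply: (meets_inf (j := (V, (a, c)) : I)); rewrite /pr /= a0 ac.
by move=> [V [a c]] /and3P[a0 ac _] ->; exists V, a, c.
Qed.

(** * Comparison with the Cambrian congruences *)

Lemma arc_con_le V U a c a' c' : (a <= a')%N -> (c' <= c)%N ->
  (forall b, (a' < b)%N -> (b < c')%N -> (b \in V) = (b \in U)) ->
  arc_con U a c <= arc_con V a' c'.
Proof.
move=> aa cc VU; apply/congr_leP => x y /arc_conP h.
apply/arc_conP => i k i0 ai ik kc.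
have -> : perm_arc V i k = perm_arc U i k by apply: arc_ext => b ib bk; apply: VU; lia.
by apply: h => //; lia.
Qed.

Lemma arc_set1 V i k : (0 < i)%N -> k = i.+1 :> nat ->
  inv_set (perm_arc V i k) = [set (i, k)].
Proof.
move=> i0 ki; apply/setP => -[p q].
by rewrite in_arc in_set1 xpair_eqE -!val_eqE /=; lia.
Qed.

Lemma arc_set2 V i j k : (0 < i)%N -> j = i.+1 :> nat -> k = i.+2 :> nat ->
  inv_set (perm_arc V i k) =
    if j \in V then [set (i, j); (i, k)] else [set (j, k); (i, k)].
Proof.
move=> i0 ji ki; apply/setP => -[p q]; rewrite in_arc.
have pj : p = j :> nat -> (p \in V) = (j \in V) by move/ord_inj->.
have qj : q = j :> nat -> (q \in V) = (j \in V) by move/ord_inj->.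
case jV: (j \in V); rewrite jV in pj qj;
  rewrite !inE !xpair_eqE -!val_eqE /=; lia.
Qed.

Lemma cambrian_collapses V U b : (1 < b)%N -> (b < n)%N ->
  (b \in V) != (b \in U) -> exists i k : 'I_n.+1,
    [/\ b = i.+1 :> nat, k = i.+2 :> nat
      & collapses (cambrian_congruence U) V i k].
Proof.
move=> b1 bn VU; pose i : 'I_n.+1 := inord b.-1; pose k : 'I_n.+1 := inord i.+2.
have iE : i = b.-1 :> nat by rewrite inordK //; lia.
have bE : b = i.+1 :> nat by lia.
have kE : k = i.+2 :> nat by rewrite inordK //; lia.
have jE : inord i.+1 = b by rewrite -bE inord_val.
have i0 : (0 < i)%N by lia.
have b0 : (0 < b)%N by lia.
have kb : k = b.+1 :> nat by lia.
exists i, k; split => //.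
(* Since V and U differ at b, the larger element of the generator at b is exactly <b-1,b+1;V>, and
   the smaller one is this one-pair arc. *)
exists (if b \in V then perm_arc V i b else perm_arc V b k); split.
- by case: ifP => _; rewrite arc_set1 // in_set1 xpair_eqE -!val_eqE /=; lia.
- apply/perm_leP => p q; rewrite (arc_set2 _ i0 bE kE).
  by case: ifP => _; rewrite arc_set1 // !inE => ->.
apply: congr_sym; apply: (subsetP (sub_con_gen _)).
rewrite inE; apply/existsP; exists i; rewrite jE /=; apply/and3P; split; try lia.
rewrite -/k -[arc_set V i k]/(inv_set (perm_arc V i k)) (arc_set2 _ i0 bE kE).
by move: VU; case: (b \in V); case: (b \in U) => // _;
  rewrite arc_set1 ?eqxx.
Qed.

Lemma cambrian_le_arc_con V U a c : (0 < a)%N -> (a < c)%N ->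
  cambrian_congruence U <= arc_con V a c ->
  forall b, (a < b)%N -> (b < c)%N -> (b \in V) = (b \in U).
Proof.
move=> a0 ac le b ab bc; apply/eqP/negPn/negP => VU.
have cn := ltn_ord c; have [||i [k [bE kE col]]] := cambrian_collapses _ _ VU; try lia.
apply: (arc_con_ncollapses a0 ac le).
by apply: collapses_spread col; lia.
Qed.

(** Each [arc_con V i k] above the Cambrian congruence has V equal to U on ]i,k[, hence contains
    [arc_con U 1 n]. Conversely, no arc with label set U separates the two sides of a generator. *)
Lemma cambrian_arc_con U a : a = 1%N :> nat ->
  cambrian_congruence U = arc_con U a ord_max.
Proof.
move=> a1; apply/le_anti/andP; split; last first.
  apply: congr_le_arc_con => V i k i0 ik /(cambrian_le_arc_con i0 ik) VU.
  by apply: arc_con_le => //; [lia | rewrite -ltnS; apply: ltn_ord].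
have -> : (cambrian_congruence U <= arc_con U a ord_max) =
  (cambrian_pairs U \subset con_set (arc_con U a ord_max)) := con_gen_min _ _.
apply/subsetP => -[x y]; rewrite inE => /existsP[i] /=.
set j : 'I_n.+1 := inord i.+1; set k : 'I_n.+1 := inord i.+2.
move=> /and3P[i0 i2 xyE].
have jE : j = i.+1 :> nat by rewrite inordK //; lia.
have kE : k = i.+2 :> nat by rewrite inordK //; lia.
apply/arc_conP => p q p0 _ pq _; apply/idP/idP.
  move/le_trans; apply; apply/perm_leP => l r.
  by move: xyE; case: ifP => _ /andP[/eqP-> /eqP->]; rewrite !inE => ->.
move=> /perm_leP Jy; have pqy := Jy _ _ (arc_ends U p0 pq).
have Uik : p = i -> q = k -> perm_arc U i k <= y by move=> <- <-; apply/perm_leP.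
have setUik := arc_set2 U i0 jE kE.
(* An arc below y has its long pair in y. If that is the simple pair, the arc is x itself; if it is
   (i,k), the arc also contains the simple pair that y lacks. *)
move: xyE pqy; case: ifP => jU /andP[/eqP xE /eqP yE]; rewrite yE !inE.
  move=> /orP[|] /eqP[pE qE].
    apply/perm_leP => l r; rewrite pE qE xE arc_set1 //; lia.
  have /perm_leP/(_ i j) := Uik pE qE; rewrite setUik jU yE !inE !xpair_eqE.
  by rewrite -!val_eqE /=; lia.
move=> /orP[|] /eqP[pE qE].
  by apply/perm_leP => l r; rewrite pE qE xE arc_set1.
have /perm_leP/(_ j k) := Uik pE qE; rewrite setUik jU yE !inE !xpair_eqE.
by rewrite -!val_eqE /=; lia.
Qed.

(** A meet-irreducible congruence [arc_con V b c] contains the Cambrian congruence of V. If it lies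
    below [arc_con U 1 n], then V and U agree on ]1,n[, so that Cambrian congruence is already
    [arc_con U 1 n]. *)
Lemma arc_con_minimal U a : a = 1%N :> nat -> (1 < n)%N ->
  minimal_meet_irreducible (arc_con U a ord_max).
Proof.
move=> a1 n1; have a0 : (0 < a)%N by rewrite a1.
have an : (a < (ord_max : 'I_n.+1))%N by rewrite a1.
split=> [|t /meet_irreducible_arc_con[V [b [c [b0 bc ->]]]] le].
  exact: arc_con_meet_irreducible.
have leV : cambrian_congruence V <= arc_con V b c.
  by rewrite (cambrian_arc_con V a1); apply: arc_con_le => //;
    [rewrite a1 | rewrite -ltnS; apply: ltn_ord].
have UV := cambrian_le_arc_con a0 an (le_trans leV le).
apply/le_anti; rewrite le /=; apply: le_trans leV.
rewrite (cambrian_arc_con V a1); apply: arc_con_le => // j aj jn.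
by rewrite UV.
Qed.

Lemma minimal_meet_irreducibleE t : (1 < n)%N -> minimal_meet_irreducible t <->
  exists2 U : {set 'I_n.+1},
    U \subset [set u : 'I_n.+1 | (2 <= u)%N && (u <= n.-1)%N] &
    t = cambrian_congruence U.
Proof.
move=> n1; pose a : 'I_n.+1 := inord 1.
have a1 : a = 1%N :> nat by rewrite inordK // ltnS ltnW.
split=> [[/meet_irreducible_arc_con[V [b [c [b0 bc tE]]]] tmin]|[U _ ->]]; last first.
  by rewrite (cambrian_arc_con U a1); apply: arc_con_minimal.
(* Labels of V outside 2..n-1 are dropped: an arc inside [1,n] depends only on the labels strictly
   between its ends. *)
exists (V :&: [set u : 'I_n.+1 | (2 <= u)%N && (u <= n.-1)%N]).
  exact: subsetIr.
apply/esym/tmin; rewrite (cambrian_arc_con _ a1).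
  by apply: arc_con_meet_irreducible; rewrite a1.
rewrite tE; apply: arc_con_le; [by rewrite a1 | by rewrite -ltnS; apply: ltn_ord |].
by move=> j bj jc; have := ltn_ord c; rewrite !inE; case: (j \in V) => //=; lia.
Qed.

End ArcCongruences.

Theorem corollary6p10 (d : Order.disp_t) (L : latticeType d) :
  (exists (n : nat) (U : {set 'I_n.+1}),
     [/\ (2 <= n)%N,
         U \subset [set u : 'I_n.+1 | (2 <= u)%N && (u <= n.-1)%N]
       & lattice_isomorphic L (quotient_lattice (cambrian_congruence U))])
  <->
  (exists (n : nat) (psi : congruence (permutohedron n)),
     [/\ (2 <= n)%N,
         minimal_meet_irreducible psi
       & lattice_isomorphic L (quotient_lattice psi)]).
Proof.
split=> [[n [U [n2 sU iso]]]|[n [psi [n2 psi_min iso]]]].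
  exists n, (cambrian_congruence U); split=> //.
  by apply/(minimal_meet_irreducibleE _ n2); exists U.
have /(minimal_meet_irreducibleE _ n2)[U sU psiE] := psi_min.
by exists n, U; split; rewrite -?psiE.
Qed.
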